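(* Let $m,n$ be integers with $n \ge m \ge 3$. Then the Cartesian product of cycles $C_m \square C_n$ is distance magic if and only if either $n=2m$ with $m$ odd, or $n=m$ with $m \equiv 2 \pmod 4$.
   Context: A graph $\Gamma=(V,E)$ of order $N$ is distance magic if there is a bijection $\ell: V \to \{1,\ldots,N\}$ such that the sum of the labels of all neighbours of $v$ (the weight of $v$) is the same for all $v \in V$. $C_m \square C_n$ denotes the Cartesian product of the cycles $C_m$ and $C_n$, i.e. the Cayley graph of $\mathbb{Z}_m \times \mathbb{Z}_n$ with connection set $\{\pm(1,0),\pm(0,1)\}$. *)

(* Defs.v *)
From mathcomp Require Import all_boot all_algebra.

Set Implicit Arguments.
Unset Strict Implicit.
Unset Printing Implicit Defensive.

Import GRing.Theory.
Local Open Scope ring_scope.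

(* A finite graph is given by its adjacency relation on a finType of vertices. *)

Definition cayley_graph (A : zmodType) (S : seq A) : rel A :=
  [rel x y | y - x \in S].

(* 'Z_n is the ring of integers mod n only for n >= 2. *)
Definition cycle_graph (n : nat) : rel 'Z_n :=
  @cayley_graph 'Z_n [:: 1; -1].

Definition cartesian_product (T1 T2 : finType) (e1 : rel T1) (e2 : rel T2) :
    rel (T1 * T2) :=
  [rel x y | (x.1 == y.1) && e2 x.2 y.2 || e1 x.1 y.1 && (x.2 == y.2)].

Definition cycle_product (m n : nat) : rel ('Z_m * 'Z_n) :=
  cartesian_product (@cycle_graph m) (@cycle_graph n).

Definition weight (T : finType) (e : rel T) (l : T -> nat) (v : T) : nat :=
  (\sum_(u | e v u) l u)%N.

Definition bijective_labelling (T : finType) (l : T -> nat) : Prop :=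
  injective l /\ forall k : nat, (exists v, l v = k) <-> (1 <= k <= #|T|)%N.

Definition distance_magic (T : finType) (e : rel T) : Prop :=
  exists2 l : T -> nat, bijective_labelling l &
    exists c : nat, forall v : T, weight e l v = c.

Lemma cycle_productE (m n : nat) (x y : 'Z_m * 'Z_n) :
  cycle_product x y =
  cayley_graph [:: (1, 0); (-1, 0); (0, 1); (0, -1)] x y.
Proof.
case: x y => [x1 x2] [y1 y2].
rewrite /cycle_product /cartesian_product /cycle_graph /cayley_graph /=.
rewrite !inE -!pair_eqE /= !subr_eq0 (eq_sym y1 x1) (eq_sym y2 x2).
by case: (x1 == y1); case: (x2 == y2); rewrite ?andbT ?andbF ?orbF //= orbC -orbA.
Qed.

Lemma card_cycle_product_vertices (m n : nat) :
  (1 < m)%N -> (1 < n)%N -> #|{: 'Z_m * 'Z_n}| = (m * n)%N.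
Proof. by move=> m1 n1; rewrite card_prod !card_ord !Zp_cast. Qed.

Lemma cycle_graph_sym (n : nat) : symmetric (@cycle_graph n).
Proof.
move=> x y; rewrite /cycle_graph /cayley_graph /= !inE -(opprB y x).
by rewrite eqr_opp eqr_oppLR orbC.
Qed.

Lemma cycle_graph_irr (n : nat) : irreflexive (@cycle_graph n).
Proof.
move=> x; rewrite /cycle_graph /cayley_graph /= subrr !inE.
by rewrite !(eq_sym 0) oppr_eq0 oner_eq0.
Qed.

(* Main.v *)
Require Import Defs.
From HB Require Import structures.
From mathcomp Require Import all_boot all_algebra.
From mathcomp Require Import zify ring.

(** Necessity.  After centring, a magic labelling is an injective function [f]
    on the torus with [f (v + a) + f (v - a) = - (f (v + b) + f (v - b))], where
    [a = (1, 0)] and [b = (0, 1)].  Up to the sign [(-1)^y] this is the discrete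
    wave equation, so the same identity holds with the steps [a] and [b]
    replaced by [k a] and [k b] and the sign by [(-1)^k].  Taking [k = m] at a
    point where [|f|] is maximal gives [n %| m] for [m] even and [n %| 2 m] for
    [m] odd; [k = m] excludes [n = m] odd, and [k = m / 2] excludes [n = m]
    divisible by 4.

    Sufficiency.  By d'Alembert's formula [(-1)^y (G (x + y) + H (x - y))]
    solves the equation; for [p] odd, [G] and [H] are chosen so that
    [G (x + y) + H (x - y)] enumerates, up to multiplicity 2, the half-odd-integers
    between 0 and half the number of vertices,
    the digits being [x + y] and [x - y] mod [p] and, if both cycles are even,
    the parity of [x + y]. *)

Set Implicit Arguments.
Unset Strict Implicit.
Unset Printing Implicit Defensive.

Import GRing.Theory.

(** * Neighbour sums on the torus *)

HB.instance Definition _ (V W : finZmodType) := GRing.Zmodule.on (V * W)%type.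

Lemma sum_cayley_graph (A : finZmodType) (S : seq A) (l : A -> nat) (v : A) :
  uniq S -> \sum_(u | cayley_graph S v u) l u = \sum_(s <- S) l (v + s)%R.
Proof.
move=> S_uniq; rewrite [RHS]big_uniq //=.
rewrite [RHS](reindex_onto (fun u => u - v)%R (fun s => v + s)%R) /=.
  by apply: eq_big => [u|u _]; rewrite /cayley_graph /= addrCA subrr addr0 ?eqxx ?andbT.
by move=> s _; rewrite addrC addKr.
Qed.

Lemma Zp_val_addn1 (M : nat) (x : 'Z_M) : 1 < M -> (x + 1)%R = x.+1 %% M :> nat.
Proof. by move=> M1; case: x => x lt_x; rewrite /= Zp_cast // (modn_small M1) addn1. Qed.

Lemma Zp_ltn (M : nat) (x : 'Z_M) : 1 < M -> x < M.
Proof. by move=> M1; have := ltn_ord x; rewrite {2}Zp_cast. Qed.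

Lemma Zp_eq_mod (M : nat) (x y : 'Z_M) : 1 < M -> x = y %[mod M] -> x = y.
Proof. by move=> M1; rewrite !modn_small ?Zp_ltn // => /ord_inj. Qed.

Lemma Zp1_neqN1 (M : nat) : 2 < M -> (1 : 'Z_M)%R != (-1)%R.
Proof.
move=> M2; rewrite -subr_eq0 opprK; apply/eqP => /(congr1 val) /=.
by rewrite Zp_cast ?modn_small //; lia.
Qed.

Lemma weight_cycle_product (m n : nat) (l : 'Z_m * 'Z_n -> nat) (v : 'Z_m * 'Z_n) :
  2 < m -> 2 < n ->
  weight (@cycle_product m n) l v =
  l (v + (1, 0))%R + l (v - (1, 0))%R + (l (v + (0, 1))%R + l (v - (0, 1))%R).
Proof.
move=> m2 n2; rewrite /weight (eq_bigl _ _ (cycle_productE v)) /=.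
rewrite sum_cayley_graph; last first.
  rewrite /= !inE -!pair_eqE /= !oppr_eq0 !(eq_sym 0%R) !oppr_eq0 !oner_eq0.
  by rewrite (negPf (Zp1_neqN1 m2)) (negPf (Zp1_neqN1 n2)).
rewrite !big_cons big_nil addn0 !addnA.
have oppE x y : (- (x, y) = (- x, - y) :> 'Z_m * 'Z_n)%R by [].
by rewrite !oppE !oppr0.
Qed.

Lemma pair_mulrn (V W : zmodType) (x : V) (y : W) (k : nat) :
  ((x, y) *+ k)%R = (x *+ k, y *+ k)%R.
Proof. by elim: k => // k IHk; rewrite !mulrS IHk. Qed.

Lemma Zp_nat_eq0 (n k : nat) : 1 < n -> (k%:R == 0 :> 'Z_n)%R = (n %| k).
Proof. by move=> n1; rewrite -val_eqE /= val_Zp_nat. Qed.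

(** * The wave equation on a finite abelian group *)

Section WaveEquation.

Variables (A : finZmodType) (f : A -> int) (a b : A).
Hypothesis waveP :
  forall v : A, (f (v + a) + f (v - a) + (f (v + b) + f (v - b)) = 0)%R.

(** Two-step induction: add case [k.+1] at [u + a] and [u - a], rewrite the right side by [waveP] at
    [u + b *+ k.+1] and [u - b *+ k.+1], and subtract case [k] at [u]. *)
Lemma wave_iter (k : nat) (v : A) :
  (f (v + a *+ k) + f (v - a *+ k)
   = (-1) ^+ k * (f (v + b *+ k) + f (v - b *+ k)))%R.
Proof.
suff: forall u : A, (f (u + a *+ k) + f (u - a *+ k)
    = (-1) ^+ k * (f (u + b *+ k) + f (u - b *+ k)) /\
  f (u + a *+ k.+1) + f (u - a *+ k.+1)
    = (-1) ^+ k.+1 * (f (u + b *+ k.+1) + f (u - b *+ k.+1)))%R by case/(_ v).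
elim: k => [|k IHk] u.
  rewrite !mulr0n !mulr1n subr0 expr0 expr1 mul1r mulN1r; split=> //.
  by have := waveP u; lia.
have [_ IHk1] := IHk u; split=> //.
have [[[IHu _] [_ IHl]] [_ IHr]] := (IHk u, IHk (u + a)%R, IHk (u - a)%R).
have [Wl Wr] := (waveP (u + b *+ k.+1)%R, waveP (u - b *+ k.+1)%R).
have shift (w z : A) (j : nat) :
    [/\ w + z *+ j.+2 = w + z + z *+ j.+1, w - z *+ j.+2 = w - z - z *+ j.+1,
        w + z - z *+ j.+1 = w - z *+ j & w - z + z *+ j.+1 = w + z *+ j]%R.
  by rewrite !(mulrS _ j.+1) !(mulrS _ j) !opprD !addrA addrK subrK; split.
have [ea1 ea2 ea3 ea4] := shift u a k.
have [eb1 eb2 eb3 eb4] := shift u b k.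
have eC (s t : A) : (u + s + t = u + t + s)%R by rewrite addrAC.
rewrite ea1 ea2 eb1 eb2.
rewrite ea3 in IHl; rewrite ea4 in IHr.
rewrite !(eC (b *+ _)%R) !(eC (- (b *+ _))%R) ?eb3 ?eb4 in Wl Wr.
move: IHu IHl IHr Wl Wr; rewrite !exprS -signr_odd.
by case: (odd k); rewrite ?expr0 ?expr1 ?mulr1 ?mulN1r ?mul1r; lia.
Qed.

Lemma exists_absz_max : exists v : A, forall w : A, `|f w|%N <= `|f v|%N.
Proof.
have [v _ v_max] := @arg_maxnP A 0%R xpredT (fun u => `|f u|%N) isT.
by exists v => w; apply: v_max.
Qed.

Hypothesis f_inj : injective f.

(** Where [|f|] is maximal, [2 f v = f (v + k b) + f (v - k b)] forces both terms to equal [f v];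
    for odd [k] both equal [- f v], hence each other. *)
Lemma wave_period_even (k : nat) : ~~ odd k -> (a *+ k = 0 -> b *+ k = 0)%R.
Proof.
move=> k_even ak0.
have [v v_max] := exists_absz_max.
have := wave_iter k v; rewrite ak0 subr0 addr0 -signr_odd (negPf k_even) mul1r => E.
have E' : f (v + b *+ k)%R = f v.
  by have := v_max (v + b *+ k)%R; have := v_max (v - b *+ k)%R; lia.
by apply: (addrI v); rewrite addr0; apply: f_inj.
Qed.

Lemma wave_period_odd (k : nat) : odd k -> (a *+ k = 0 -> b *+ (2 * k) = 0)%R.
Proof.
move=> k_odd ak0.
have [v v_max] := exists_absz_max.
have := wave_iter k v; rewrite ak0 subr0 addr0 -signr_odd k_odd mulN1r => E.
have E' : f (v + b *+ k)%R = f (v - b *+ k)%R.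
  by have := v_max (v + b *+ k)%R; have := v_max (v - b *+ k)%R; lia.
have {E'} /f_inj /addrI bk := E'.
by rewrite mul2n -addnn mulrnDr {2}bk subrr.
Qed.

End WaveEquation.

(** * Necessity *)

Lemma cycle_product_magic_only_if (m n : nat) : 2 < m -> m <= n ->
  distance_magic (@cycle_product m n) ->
  (n = 2 * m /\ odd m) \/ (n = m /\ m = 2 %[mod 4]).
Proof.
move=> m2 le_mn [l [l_inj _] [c l_magic]].
have n2 : 2 < n by apply: leq_trans le_mn.
set a : 'Z_m * 'Z_n := (1, 0)%R; set b : 'Z_m * 'Z_n := (0, 1)%R.
(* A vertex has four neighbours, so the labels are centred at [c / 4]; the factor 4 keeps [f]
   integral. *)
pose f (v : 'Z_m * 'Z_n) : int := (4 * (l v)%:Z - c%:Z)%R.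
have f_inj : injective f by move=> u v; rewrite /f => E; apply: l_inj; lia.
have fW (v : 'Z_m * 'Z_n) : (f (v + a) + f (v - a) + (f (v + b) + f (v - b)) = 0)%R.
  have : l (v + a)%R + l (v - a)%R + (l (v + b)%R + l (v - b)%R) = c.
    by rewrite -(l_magic v) weight_cycle_product.
  by rewrite /f; lia.
have ak k : (a *+ k == 0)%R = (m %| k).
  rewrite pair_mulrn -pair_eqE /= mul0rn eqxx andbT Zp_nat_eq0 //; lia.
have bk k : (b *+ k == 0)%R = (n %| k).
  rewrite pair_mulrn -pair_eqE /= mul0rn eqxx /= Zp_nat_eq0 //; lia.
have am0 : (a *+ m = 0)%R by apply/eqP; rewrite ak.
have [m_odd|m_even] := boolP (odd m).
  have /eqP := wave_period_odd fW f_inj m_odd am0.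
  (* As [n >= m], the quotient of [2 * m] by [n] is 1 or 2; only the value 2, that is [n = m],
     survives [lia]. *)
  rewrite bk => /dvdnP [[|[|[|q]]]] m_eq; try lia.
  have /eqP bm0 : (b *+ m == 0)%R by rewrite bk; apply/dvdnP; exists 1; lia.
  have f0 v : f v = 0%R.
    have := wave_iter fW m v; rewrite am0 bm0 subr0 addr0 -signr_odd m_odd.
    by rewrite mulN1r; lia.
  have /eqP : a = 0%R by apply: f_inj; rewrite !f0.
  by rewrite -[a]mulr1n ak dvdn1; lia.
have /eqP := wave_period_even fW f_inj m_even am0.
rewrite bk => n_dvd_m; have := dvdn_leq (ltnW (ltnW m2)) n_dvd_m => le_nm.
have nm : n = m by lia.
right; split=> //.
have := divn_eq m 4; have := ltn_pmod m (isT : 0 < 4).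
case: (m %% 4) => [|[|[|[|?]]]] // _ m_eq; try lia.
(* [h = m / 2] is even, and [a *+ h], [b *+ h] are their own opposites, so [wave_iter] at 0 makes
   [f] agree at these two points. *)
pose h := 2 * (m %/ 4).
have oddh : odd h = false by rewrite /h; lia.
have hN (z : 'Z_m * 'Z_n) : (z *+ m = 0)%R -> (- (z *+ h) = z *+ h)%R.
  move=> z0; apply/eqP; rewrite eq_sym -subr_eq0 opprK -mulrnDr.
  by apply/eqP; rewrite -[RHS]z0; congr (_ *+ _)%R; rewrite /h; lia.
have bm0 : (b *+ m = 0)%R by apply/eqP; rewrite bk.
have E : (f (a *+ h) + f (a *+ h) = f (b *+ h) + f (b *+ h))%R.
  by have := wave_iter fW h 0%R; rewrite -signr_odd oddh mul1r !add0r !hN.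
have /eqP : (a *+ h = b *+ h)%R by apply: f_inj; lia.
rewrite !pair_mulrn -pair_eqE /= mul0rn Zp_nat_eq0; last by lia.
by case/andP=> /dvdn_leq; rewrite /h; lia.
Qed.

(** * Labellings by counting, and residues mod [p] *)

Lemma bijective_labellingP (T : finType) (l : T -> nat) :
  injective l -> (forall v, 1 <= l v <= #|T|) -> bijective_labelling l.
Proof.
move=> l_inj l_bnd; split=> // k; split=> [[v <-] //|k_bnd].
have le_sub : {subset map l (enum T) <= iota 1 #|T|}.
  by move=> _ /mapP [v _ ->]; rewrite mem_iota add1n ltnS.
have l_uniq : uniq (map l (enum T)) by rewrite map_inj_uniq ?enum_uniq.
have le_size : size (iota 1 #|T|) <= size (map l (enum T)).
  by rewrite size_iota size_map -cardE.
have [_ /(_ k)] := uniq_min_size l_uniq le_sub le_size.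
by rewrite mem_iota add1n ltnS k_bnd => /mapP [v _ ->]; exists v.
Qed.

Lemma odd_Zp_addn1 (M : nat) (x : 'Z_M) :
  1 < M -> ~~ odd M -> odd (x + 1)%R = ~~ odd x.
Proof. by move=> M1 M_even; rewrite Zp_val_addn1 // odd_mod // (negPf M_even). Qed.

Lemma odd_Zp_subn1 (M : nat) (x : 'Z_M) :
  1 < M -> ~~ odd M -> odd (x - 1)%R = ~~ odd x.
Proof. by move=> M1 M_even; rewrite -{2}[x](subrK 1%R) odd_Zp_addn1 ?negbK. Qed.

Definition Zp_reduce (M p : nat) (x : 'Z_M) : 'Z_p := ((x : nat)%:R)%R.

Lemma Zp_reduceD1 (M p : nat) (x : 'Z_M) :
  1 < M -> 1 < p -> p %| M -> Zp_reduce p (x + 1)%R = (Zp_reduce p x + 1)%R.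
Proof.
move=> M1 p1 p_dvd; apply: ord_inj; rewrite /Zp_reduce natr1 !val_Zp_nat //.
by rewrite Zp_val_addn1 // modn_dvdm.
Qed.

Lemma Zp_reduceB1 (M p : nat) (x : 'Z_M) :
  1 < M -> 1 < p -> p %| M -> Zp_reduce p (x - 1)%R = (Zp_reduce p x - 1)%R.
Proof. by move=> *; rewrite -{2}[x](subrK 1%R) Zp_reduceD1 // addrK. Qed.

Lemma Zp_reduce_eq (M p : nat) (x y : 'Z_M) :
  1 < p -> Zp_reduce p x = Zp_reduce p y -> x = y %[mod p].
Proof. by move=> p1 /(congr1 (@nat_of_ord _)); rewrite /Zp_reduce !val_Zp_nat. Qed.

Lemma digits_inj (p s s' d d' : nat) :
  s < p -> s' < p -> s + p * d = s' + p * d' -> s = s' /\ d = d'.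
Proof.
move=> lt_s lt_s' E; have p0 : 0 < p by lia.
split.
  have := congr1 (modn^~ p) E.
  by rewrite /= ![_ + p * _]addnC ![p * _]mulnC !modnMDl !modn_small.
have := congr1 (divn^~ p) E.
by rewrite /= ![_ + p * _]addnC ![p * _]mulnC !divnMDl // !divn_small // !addn0.
Qed.

(** * Sufficiency: the explicit labelling *)

Section MagicLabelling.

(* Both families at once: [C_p x C_2p] for [t = false], [C_2p x C_2p] for
   [t = true]. *)
Variables (p : nat) (t : bool) (M N : nat).
Hypotheses (p_odd : odd p) (p3 : 2 < p) (ME : M = t.+1 * p) (NE : N = 2 * p).

Let rM := @Zp_reduce M p.
Let rN := @Zp_reduce N p.

Definition torus_code (x : 'Z_M) (y : 'Z_N) : nat :=
  (rM x + rN y)%R + p * ((rM x - rN y)%R + p * (t && (odd x (+) odd y))).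

(** The label is [p * M + 1/2] plus [(-1)^y (torus_code + 1/2)]. *)
Definition torus_label (v : 'Z_M * 'Z_N) : nat :=
  if odd v.2 then p * M - torus_code v.1 v.2 else (p * M + torus_code v.1 v.2).+1.

Let p1 : 1 < p := ltnW p3.
Let M1 : 1 < M. Proof. by rewrite ME; lia. Qed.
Let N1 : 1 < N. Proof. by rewrite NE; lia. Qed.
Let M3 : 2 < M. Proof. by rewrite ME; lia. Qed.
Let N3 : 2 < N. Proof. by rewrite NE; lia. Qed.
Let N_even : ~~ odd N. Proof. by rewrite NE mul2n odd_double. Qed.
Let pM : p %| M. Proof. by rewrite ME dvdn_mull. Qed.
Let pN : p %| N. Proof. by rewrite NE dvdn_mull. Qed.

Lemma torus_code_lt (x : 'Z_M) (y : 'Z_N) : torus_code x y < p * M.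
Proof.
rewrite /torus_code; set s := nat_of_ord _; set d := nat_of_ord _.
have [lt_s lt_d] : s < p /\ d < p by rewrite !Zp_ltn.
have MEt := ME; move: (odd x (+) odd y) => e.
have lt_M : d + p * (t && e) < M by case: t MEt => MEt; case: e => /=; lia.
by have := leq_mul (leqnn p) lt_M; rewrite mulnS; lia.
Qed.

(** On both sides each of the digits [x + y] and [x - y] moves once by 1 and once by -1, and the
    parity digit flips in all four terms. *)
Lemma torus_code_neighbours (x : 'Z_M) (y : 'Z_N) :
  torus_code (x + 1)%R y + torus_code (x - 1)%R y =
  torus_code x (y + 1)%R + torus_code x (y - 1)%R.
Proof.
rewrite /torus_code.
rewrite /rM /rN !Zp_reduceD1 // !Zp_reduceB1 //.
rewrite !(@odd_Zp_addn1 N) // !(@odd_Zp_subn1 N) //.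
have tM z : (t && (odd (x + 1)%R (+) z) = t && (~~ odd x (+) z)) /\
            (t && (odd (x - 1)%R (+) z) = t && (~~ odd x (+) z)).
  case: t ME => //= ME2; have M_even : ~~ odd M by rewrite ME2 mul2n odd_double.
  by rewrite odd_Zp_addn1 // odd_Zp_subn1.
rewrite !(proj1 (tM _)) !(proj2 (tM _)) !addNb !addbN.
move: (Zp_reduce p x) (Zp_reduce p y) => r q.
have -> : (r + 1 + q = r + (q + 1))%R by ring.
have -> : (r + 1 - q = r - (q - 1))%R by ring.
have -> : (r - 1 + q = r + (q - 1))%R by ring.
have -> : (r - 1 - q = r - (q + 1))%R by ring.
lia.
Qed.

Lemma torus_label_inj : injective torus_label.
Proof.
move=> [x y] [x' y'] E.
have [lt1 lt2] := (torus_code_lt x y, torus_code_lt x' y').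
(* Labels up to [p * M] belong to odd [y], larger ones to even [y]. *)
have [Ey Ec] : odd y = odd y' /\ torus_code x y = torus_code x' y'.
  by move: E; rewrite /torus_label /=; case: (odd y) (odd y') => [] []; lia.
move: Ec; rewrite /torus_code => /digits_inj [||Es /digits_inj [||Ed Et]];
  rewrite ?Zp_ltn //.
have {}Es := val_inj Es; have {}Ed := val_inj Ed.
(* Sum and difference determine [x] and [y] mod [p] since 2 is invertible; the parities then lift
   this to [N] and [M]. *)
have two_unit : (2%:R : 'Z_p)%R \is a GRing.unit.
  by rewrite unitZpE // coprime_sym coprime2n.
have Ex : rM x = rM x'.
  apply: (mulrI two_unit).
  have -> : (2%:R * rM x = (rM x + rN y) + (rM x - rN y))%R by ring.
  by rewrite Es Ed; ring.
have Er : rN y = rN y' by move: Es; rewrite Ex; apply: addrI.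
have co : coprime 2 p by rewrite coprime2n.
have {}Ey : y = y'.
  apply: Zp_eq_mod => //; suff: y = y' %[mod 2 * p] by rewrite -NE.
  apply/eqP; rewrite chinese_remainder // !modn2 Ey eqxx; exact/eqP/Zp_reduce_eq.
have Ex' : x = x'.
  apply: Zp_eq_mod => //; suff: x = x' %[mod t.+1 * p] by rewrite -ME.
  have {}Ex := Zp_reduce_eq p1 Ex; rewrite Ey in Et.
  case: t Et => /= Et; last by rewrite mul1n.
  apply/eqP; rewrite chinese_remainder // Ex eqxx andbT !modn2.
  by move: Et; case: (odd x); case: (odd x'); case: (odd y').
by rewrite Ey Ex'.
Qed.

Lemma torus_label_magic : distance_magic (@cycle_product M N).
Proof.
exists torus_label.
  apply: bijective_labellingP torus_label_inj _ => -[x y].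
  rewrite card_cycle_product_vertices // /torus_label.
  have MN : M * N = 2 * (p * M) by rewrite NE; lia.
  by have := torus_code_lt x y => /=; case: ifP => _; lia.
(* Four times the centre [p * M + 1/2]: the code terms cancel, since the sign alternates with
   [y]. *)
exists (4 * (p * M) + 2) => -[x y]; rewrite weight_cycle_product //.
have labelE x' y' : torus_label (x', y') =
    if odd y' then p * M - torus_code x' y' else (p * M + torus_code x' y').+1 by [].
have -> : ((x, y) + (1, 0) = (x + 1, y) :> 'Z_M * 'Z_N)%R.
  by congr pair; rewrite addr0.
have -> : ((x, y) - (1, 0) = (x - 1, y) :> 'Z_M * 'Z_N)%R.
  by congr pair; rewrite subr0.
have -> : ((x, y) + (0, 1) = (x, y + 1) :> 'Z_M * 'Z_N)%R.
  by congr pair; rewrite addr0.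
have -> : ((x, y) - (0, 1) = (x, y - 1) :> 'Z_M * 'Z_N)%R.
  by congr pair; rewrite subr0.
rewrite !labelE odd_Zp_addn1 // odd_Zp_subn1 //.
have := torus_code_neighbours x y; have lt := torus_code_lt.
have := (lt (x + 1) y, lt (x - 1) y, lt x (y + 1), lt x (y - 1))%R.
by case: (odd y) => /= -[[[? ?] ?] ?]; lia.
Qed.

End MagicLabelling.

Theorem theorem1p1 (m n : nat) (hm : 3 <= m) (hmn : m <= n) :
  distance_magic (@cycle_product m n) <->
  (n = 2 * m /\ odd m) \/ (n = m /\ m = 2 %[mod 4]).
Proof.
split; first exact: cycle_product_magic_only_if.
case=> [[nE m_odd]|[nE m_mod4]].
  by apply: (@torus_label_magic m false); rewrite ?mul1n.
have mE := divn_eq m 4; rewrite m_mod4 in mE.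
(* Here [p = m / 2] is odd, and at least 3 because [m >= 6]. *)
apply: (@torus_label_magic (2 * (m %/ 4) + 1) true); lia.
Qed.
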